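(* Let $K$ be a field with $\operatorname{char}(K)=0$, $S=K[x_1,\ldots,x_n]$ the standard graded polynomial ring, and $\mathbf{a}=(a_1,\ldots,a_n)$ a vector with $2\leq a_i\leq\infty$ for all $i$. Let $I\subset S$ be an $\mathbf{a}$-stable ideal. Then $I$ is componentwise linear.
   Context: For $u=(u_1,\ldots,u_n)\in\mathbb{N}^n$ write $x^u=x_1^{u_1}\cdots x_n^{u_n}$ and $m(u)=\max\{i\in\{1,\ldots,n\}: u_i\neq 0\}$. For a monomial ideal $I$, $G(I)$ is its unique minimal system of monomial generators. Each $a_i$ is an integer $\geq 2$ or $\infty$ (with $\infty-1=\infty$). A monomial ideal $I\subset S$ is $\mathbf{a}$-bounded if $u_i<a_i$ for all $x^u\in G(I)$ and all $i\in\{1,\ldots,n\}$. It is $\mathbf{a}$-stable if it is $\mathbf{a}$-bounded and, in addition, for all $x^u\in G(I)$ and all $j\leq m(u)$ with $u_j<a_j-1$ one has $x_jx^u/x_{m(u)}\in I$. For a graded ideal $I$ and $d\geq 0$, $I_{\langle d\rangle}\subseteq I$ is the ideal generated by all homogeneous elements of degree $d$ in $I$. With $\beta^S_{i,j}(J)=\dim_K\operatorname{Tor}^S_i(J,K)_j$, a graded ideal $J$ has a $d$-linear resolution if $\beta^S_{i,i+j}(J)=0$ for all $i$ and all $j\neq d$ (the zero ideal satisfies this trivially). $I$ is componentwise linear if for all $d\geq 0$ the ideal $I_{\langle d\rangle}$ has a $d$-linear resolution. *)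

(* Defs.v *)
From HB Require Import structures.
From mathcomp Require Import all_boot all_order all_algebra.
From mathcomp Require Export mpoly.

Set Implicit Arguments.
Unset Strict Implicit.
Unset Printing Implicit Defensive.

Import Order.TTheory GRing.Theory Num.Theory.
Local Open Scope ring_scope.

(** Ideals, and subsets of the polynomial ring in general, are Prop-valued
    predicates. *)

Definition ideal_gen (R : comNzRingType) (A : R -> Prop) (p : R) : Prop :=
  exists2 s : seq (R * R),
    (forall x, x \in s -> A x.2) & p = \sum_(x <- s) x.1 * x.2.

Definition monomials (K : fieldType) (n : nat) (U : 'X_{1..n} -> Prop)
    (p : {mpoly K[n]}) : Prop :=
  exists2 u, U u & p = 'X_[u].

Definition mon_gens (K : fieldType) (n : nat) (I : {mpoly K[n]} -> Prop)
    (U : 'X_{1..n} -> Prop) : Prop :=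
  forall p, I p <-> ideal_gen (monomials U) p.

Definition monomial_ideal (K : fieldType) (n : nat)
    (I : {mpoly K[n]} -> Prop) : Prop :=
  exists U, mon_gens I U.

Definition min_mon_gens (K : fieldType) (n : nat) (I : {mpoly K[n]} -> Prop)
    (U : 'X_{1..n} -> Prop) : Prop :=
  mon_gens I U /\
  forall V : 'X_{1..n} -> Prop, (forall u, V u -> U u) -> mon_gens I V ->
    forall u, U u -> V u.

(** [G I u] : x^u belongs to G(I), the minimal system being unique. *)
Definition G (K : fieldType) (n : nat) (I : {mpoly K[n]} -> Prop)
    (u : 'X_{1..n}) : Prop :=
  exists2 U, min_mon_gens I U & U u.

(** Bounds are elements of [option nat], with [None] standing for infinity. *)

Definition leq_bound (m : nat) (b : option nat) : bool :=
  if b is Some c then (m <= c)%N else true.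

Definition ltn_bound (m : nat) (b : option nat) : bool :=
  if b is Some c then (m < c)%N else true.

Definition pred_bound (b : option nat) : option nat := omap predn b.

(** [is_m u k] : k is the index m(u) = max {i | u_i <> 0}.  No k qualifies
    when u = 0, so the exchange condition below is then void. *)
Definition is_m (n : nat) (u : 'X_{1..n}) (k : 'I_n) : bool :=
  (u k != 0%N) && [forall i : 'I_n, (u i != 0%N) ==> (i <= k)%N].

Definition a_bounded (K : fieldType) (n : nat) (a : 'I_n -> option nat)
    (I : {mpoly K[n]} -> Prop) : Prop :=
  monomial_ideal I /\
  forall u, G I u -> forall i : 'I_n, ltn_bound (u i) (a i).

Definition a_stable (K : fieldType) (n : nat) (a : 'I_n -> option nat)
    (I : {mpoly K[n]} -> Prop) : Prop :=
  a_bounded a I /\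
  forall u, G I u -> forall k j : 'I_n,
    is_m u k -> (j <= k)%N -> ltn_bound (u j) (pred_bound (a j)) ->
    I 'X_[(U_(j) + u - U_(k))%MM].

(** p lies in the degree z component of the polynomial ring. *)
Definition homog_int (K : fieldType) (n : nat) (z : int) (p : {mpoly K[n]}) :
    Prop :=
  if z is Posz k then p \is k.-homog else p = 0.

(** Data of a complex ... -> F_1 -> F_0 -> S of graded free S-modules of finite
    rank: F_i is the module of row vectors of length [rk i], its basis vector
    [b] sits in degree [deg b], and matrices act by right multiplication. *)
Record free_complex (K : fieldType) (n : nat) := FreeComplex {
  rk : nat -> nat;
  deg : forall i, 'I_(rk i) -> int;
  diff : forall i, 'M[{mpoly K[n]}]_(rk i.+1, rk i);
  aug : 'cV[{mpoly K[n]}]_(rk 0)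
}.

(** The maps preserve degrees and ... -> F_1 -> F_0 -> J -> 0 is exact. *)
Definition graded_free_resolution (K : fieldType) (n : nat)
    (J : {mpoly K[n]} -> Prop) (F : free_complex K n) : Prop :=
  [/\ (forall b, homog_int (deg b) (aug F b 0)),
      (forall i b c, homog_int (deg b - deg c) (diff F i b c)),
      (forall p, J p <-> exists v : 'rV_(rk F 0), p = (v *m aug F) 0 0),
      (forall v : 'rV_(rk F 0),
         v *m aug F = 0 <-> exists w, v = w *m diff F 0)
    & (forall i (v : 'rV_(rk F i.+1)),
         v *m diff F i = 0 <-> exists w, v = w *m diff F i.+1)].

(** The complex F (x)_S K, where K = S/(x_1, ..., x_n): its i-th term is
    K^(rk i), and its differential keeps the constant terms of [diff]. *)
Definition diffK (K : fieldType) (n : nat) (F : free_complex K n) (i : nat) :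
    'M[K]_(rk F i.+1, rk F i) :=
  map_mx (mcoeff 0%MM) (diff F i).

(** Subspaces are given as row spaces. *)

Definition compK (K : fieldType) (n : nat) (F : free_complex K n) (i : nat)
    (j : int) : 'M[K]_(rk F i) :=
  diag_mx (\row_b (deg b == j)%:R).

Definition cyclesK (K : fieldType) (n : nat) (F : free_complex K n) (i : nat)
    (j : int) : 'M[K]_(rk F i) :=
  match i return 'M[K]_(rk F i) with
  | 0 => compK F 0 j
  | i'.+1 => (compK F i'.+1 j :&: kermx (diffK F i'))%MS
  end.

Definition boundariesK (K : fieldType) (n : nat) (F : free_complex K n)
    (i : nat) (j : int) : 'M[K]_(rk F i.+1, rk F i) :=
  compK F i.+1 j *m diffK F i.

(** dim_K H_i(F (x)_S K)_j *)
Definition dim_homK (K : fieldType) (n : nat) (F : free_complex K n) (i : nat)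
    (j : int) : nat :=
  (\rank (cyclesK F i j) - \rank (boundariesK F i j))%N.

(** [is_betti J i j b] : b = dim_K Tor^S_i(J, K)_j.  Tor is computed from a
    graded free resolution of J and does not depend on its choice. *)
Definition is_betti (K : fieldType) (n : nat) (J : {mpoly K[n]} -> Prop)
    (i : nat) (j : int) (b : nat) : Prop :=
  exists2 F : free_complex K n,
    graded_free_resolution J F & dim_homK F i j = b.

Definition linear_resolution (K : fieldType) (n : nat) (d : nat)
    (J : {mpoly K[n]} -> Prop) : Prop :=
  forall (i : nat) (j : int), j <> d%:Z -> is_betti J i (i%:Z + j) 0.

(** The ideal I_<d>. *)
Definition component_ideal (K : fieldType) (n : nat) (d : nat)
    (I : {mpoly K[n]} -> Prop) : {mpoly K[n]} -> Prop :=
  ideal_gen (fun p => I p /\ p \is d.-homog).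

Definition componentwise_linear (K : fieldType) (n : nat)
    (I : {mpoly K[n]} -> Prop) : Prop :=
  forall d : nat, linear_resolution d (component_ideal d I).

(* Main.v *)
Require Import Defs.
From mathcomp Require Import all_boot all_order all_algebra.
From mathcomp Require Import mpoly.
From Stdlib Require Import Classical.

(** The reason for componentwise linearity is that each component [I_<d>] has
    linear quotients: its monomials of degree [d] can be listed so that, for
    each [u] in the list, the colon ideal of the earlier ones by x^u is
    generated by variables.

    Linear quotients give a linear resolution by iterated mapping cones.  If
    [J] has a d-linear resolution, [m] is homogeneous of degree [d] and the
    ideal [J : m] has a 1-linear resolution, then a resolution of [J + (m)] is
    obtained from those of [J] and of [J : m], because the kernel of
    [J + S -> J + (m)] consists of the [(v, c)] with [c] in [J : m]
    ([ideal_lin_res_add]); the comparison map of the two resolutions can be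
    chosen linear since everything is graded.  An ideal generated by variables
    is itself built in this way, each colon ideal being the ideal already
    built ([ideal_lin_res_vars]).  A resolution whose i-th module sits in
    degree [d + i] has no homology in the other degrees after tensoring with
    [K] ([ideal_lin_res_linear]).

    Linear quotients of the generators come from stability.  The generators of
    degree at most [d] are listed by increasing degree, and
    lexicographically decreasing within a degree.  If [v] precedes [u], some
    [j < m(u)] satisfies [u_j < v_j]: otherwise moving the excess variables of
    [v] into the places where [u] is larger, which stability allows since the
    exponents of [u] are within the bounds, leads from [v] to ever earlier
    generators and can end only at [u] ([a_stable_key_le]).  For such a [j],
    [u_j < v_j < a_j], and so [x_j x^u / x_m(u)] lies in [I]; a generator
    dividing it precedes [u] and divides [x_j x^u], so [x_j] is in the colon
    ideal.

    Linear quotients pass from generators to components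
    ([linear_quotients_component]): the monomials of degree [d] are sorted by
    the position of the first generator that divides them, then
    lexicographically. *)

Set Implicit Arguments.
Unset Strict Implicit.
Unset Printing Implicit Defensive.

Import Order.TTheory GRing.Theory.
Local Open Scope ring_scope.

(** * Linear resolutions and mapping cones *)

Section LinearResolutions.

Variables (K : fieldType) (n : nat).
Local Notation S := {mpoly K[n]}.

Definition homog_mx e r s (A : 'M[S]_(r, s)) : Prop :=
  forall i j, A i j \is e.-homog.

Definition exact_at q r s (D : 'M[S]_(q, r)) (A : 'M[S]_(r, s)) : Prop :=
  forall v : 'rV_r, v *m A = 0 <-> exists w, v = w *m D.

(** The cokernel of [A] has a resolution that continues [A] by at most [k]
    matrices of linear forms.  Only finite resolutions are needed, and bounding
    the length makes this a plain recursive proposition: building one never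
    calls for a choice of infinitely many matrices. *)
Fixpoint lin_res k r s (A : 'M[S]_(r, s)) : Prop :=
  if k is k'.+1 then
    exists q (D : 'M[S]_(q, r)),
      [/\ homog_mx 1 D, exact_at D A & lin_res k' D]
  else r = 0%N.

Lemma lin_resS k r s (A : 'M[S]_(r, s)) : lin_res k A -> lin_res k.+1 A.
Proof.
elim: k r s A => [|k IHk] r s A /=; last first.
  by case=> q [D [hD eD /IHk rD]]; exists q, D.
move=> r0; subst r; exists 0%N, 0; split=> // [[] //|v].
by split=> _; [exists 0|]; rewrite [v]thinmx0 ?mul0mx.
Qed.

Lemma lin_res_leq k l r s (A : 'M[S]_(r, s)) :
  (k <= l)%N -> lin_res k A -> lin_res l A.
Proof.
move=> /subnKC <-; elim: (l - k)%N => [|m IHm]; first by rewrite addn0.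
by rewrite addnS => /IHm /lin_resS.
Qed.

Lemma pihomogM e f (p q : S) : q \is f.-homog ->
  pihomog mdeg (e + f) (p * q) = pihomog mdeg e p * q.
Proof.
move=> hq; rewrite {1}[p]mpolyE [in RHS]pihomogE mulr_suml raddf_sum mulr_suml /=.
rewrite [RHS]big_mkcond /=; apply: eq_bigr => m _.
rewrite -scalerAl linearZ /=.
have hm : 'X_[m] * q \is (mdeg m + f).-homog by rewrite dhomogM // dhomogX.
case: eqP => [me|/eqP me]; first by rewrite pihomog_dE -?me // scalerAl.
by rewrite (pihomog_ne0 _ hm) ?scaler0 // eqn_add2r.
Qed.

(** Comparison maps can be chosen linear: in a factorization through [A] only
    the degree one part of each coefficient contributes to the degree of [M]. *)
Lemma homog_lift e q r s (A : 'M[S]_(r, s)) (M : 'M[S]_(q, s)) :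
  homog_mx e A -> homog_mx e.+1 M ->
  (forall i, exists w, row i M = w *m A) ->
  exists2 L : 'M[S]_(q, r), homog_mx 1 L & M = L *m A.
Proof.
move=> hA hM /fin_all_exists [w wE].
exists (\matrix_(i, j) pihomog mdeg 1 (w i 0 j)) => [i j|].
  by rewrite mxE pihomogP.
apply/matrixP=> i j; have /rowP/(_ j) := wE i.
rewrite !mxE => Mij; rewrite -(pihomog_dE (hM i j)) Mij raddf_sum /=.
by apply: eq_bigr => k _; rewrite mxE -add1n pihomogM.
Qed.

Lemma homog_block e r1 r2 s1 s2 (A : 'M[S]_(r1, s1)) (B : 'M[S]_(r2, s2))
    (C : 'M[S]_(r2, s1)) :
  homog_mx e A -> homog_mx e B -> homog_mx e C ->
  homog_mx e (block_mx A 0 C B).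
Proof.
move=> hA hB hC i j; rewrite -[i]splitK -[j]splitK.
case: (fintype.split i) => i'; case: (fintype.split j) => j';
  rewrite /= ?block_mxEul ?block_mxEur ?block_mxEdl ?block_mxEdr //.
by rewrite mxE rpred0.
Qed.

(** Exactness of a mapping cone at one spot.  The predicate [P] is [w *m B = 0]
    inside the cone, where the condition on [C] then holds automatically; at
    the foot of the cone it is trivial, and that condition becomes the
    membership of [w] in the colon ideal. *)
Lemma cone_syzygies r s q rA rB (A : 'M[S]_(r, s)) (C : 'M[S]_(q, s))
    (DA : 'M[S]_(rA, r)) (DB : 'M[S]_(rB, q)) (L : 'M[S]_(rB, r))
    (P : 'rV[S]_q -> Prop) :
  exact_at DA A ->
  (forall w, (exists w', w = w' *m DB) <->
             P w /\ exists v, w *m C = v *m A) ->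
  - (DB *m C) = L *m A ->
  forall v w, v *m A + w *m C = 0 /\ P w <->
    exists z, row_mx v w = z *m block_mx DA 0 L DB.
Proof.
move=> eDA eDB LE v w; split=> [[vw Pw]|[z]].
  have wC : w *m C = - v *m A.
    by apply/eqP; rewrite mulNmx -addr_eq0 addrC vw.
  have /eDB [w' wE] : P w /\ exists v, w *m C = v *m A
    by split=> //; exists (- v).
  have /eDA [v' v'E] : (v - w' *m L) *m A = 0.
    by rewrite mulmxBl -mulmxA -LE mulmxN opprK mulmxA -wE.
  exists (row_mx v' w').
  by rewrite mul_row_block mulmx0 add0r -v'E wE subrK.
rewrite -[z]hsubmxK mul_row_block mulmx0 add0r => /eq_row_mx [-> wE].
have /eDB [Pw _] : exists w', w = w' *m DB by exists (rsubmx z).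
split=> //; have /eDA DA0 : exists w1, lsubmx z *m DA = w1 *m DA.
  by exists (lsubmx z).
by rewrite mulmxDl DA0 add0r wE -!mulmxA -LE mulmxN addNr.
Qed.

(** Horseshoe lemma for linear resolutions.  The kernel condition says that [C]
    induces a map from the image of [B] to the cokernel of [A]; lifting it one
    step further gives the same situation for the next matrices, with [L]
    in the role of [C]. *)
Lemma lin_res_block k e r s q p
    (A : 'M[S]_(r, s)) (B : 'M[S]_(q, p)) (C : 'M[S]_(q, s)) :
  homog_mx e A -> homog_mx e C -> lin_res k A -> lin_res k B ->
  (forall w : 'rV_q, w *m B = 0 -> exists v, w *m C = v *m A) ->
  lin_res k (block_mx A 0 C B).
Proof.
elim: k e r s q p A B C => [|k IHk] e r s q p A B C hA hC /=.
  by move=> r0 q0 _; rewrite r0 q0.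
move=> [rA [DA [hDA eDA resA]]] [rB [DB [hDB eDB resB]]] kerBC.
have [||i|L hL LE] := @homog_lift e rB r s A (- (DB *m C)); rewrite //.
- move=> i j; rewrite !mxE rpredN; apply: rpred_sum => l _.
  by rewrite -add1n dhomogM.
- have /kerBC [v vE] : row i DB *m B = 0.
    by apply/eDB; exists (delta_mx 0 i); rewrite -rowE.
  by exists (- v); rewrite mulNmx -vE -row_mul linearN.
exists (rA + rB)%N, (block_mx DA 0 L DB); split; first exact: homog_block.
- move=> v; rewrite -[v]hsubmxK mul_row_block mulmx0 add0r -row_mx0.
  have eDB' (w : 'rV_q) : (exists w', w = w' *m DB) <->
      w *m B = 0 /\ exists v, w *m C = v *m A.
    by split=> [/eDB wB|[/eDB]//]; split=> //; apply: kerBC.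
  rewrite -(cone_syzygies eDA eDB' LE).
  by split=> [/eq_row_mx[]//|[-> ->]].
- apply: (IHk 1%N) => // w wDB; apply/eDA.
  by rewrite -mulmxA -LE mulmxN mulmxA wDB mul0mx oppr0.
Qed.

Definition ideal_lin_res d (J : S -> Prop) : Prop :=
  exists k r (A : 'cV[S]_r),
    [/\ homog_mx d A, forall p, J p <-> exists v : 'rV_r, p = (v *m A) 0 0
      & lin_res k A].

Lemma ideal_lin_res_ext d (J J' : S -> Prop) :
  (forall p, J p <-> J' p) -> ideal_lin_res d J -> ideal_lin_res d J'.
Proof.
move=> JJ' [k [r [A [hA JE rA]]]]; exists k, r, A; split=> // p.
by rewrite -JE JJ'.
Qed.

Lemma ideal_lin_res0 d : ideal_lin_res d (fun p => p = 0).
Proof.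
exists 0%N, 0%N, 0; split=> // [[]//|p].
by split=> [->|[v ->]]; [exists 0|]; rewrite ?mulmx0 mxE.
Qed.

(** The mapping cone step, for the exact sequence
    0 -> J -> J + (m) -> (S / (J : m))(-d) -> 0.  The resolution of [J : m]
    enters shifted by one, since it is the first syzygy of the quotient. *)
Lemma ideal_lin_res_add d (m : S) (J L : S -> Prop) : m \is d.-homog ->
  ideal_lin_res d J -> ideal_lin_res 1 L ->
  (forall c, J (c * m) <-> L c) ->
  ideal_lin_res d (fun p => exists c q, J q /\ p = q + c * m).
Proof.
move=> hm [kA [r [A [hA JE rA]]]] [kB [q [B [hB LE rB]]]] colon.
pose k := maxn kA kB.
have {rA} /= [rA [DA [hDA eDA resA]]] : lin_res k.+1 A.
  by apply/lin_resS/(lin_res_leq _ rA)/leq_maxl.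
have {rB} resB : lin_res k B by apply: (lin_res_leq _ rB); apply: leq_maxr.
have M1 (M : 'M[S]_1) : M = (M 0 0)%:M by rewrite [LHS]mx11_scalar.
have [||i|C hC CE] := @homog_lift d q r 1 A (- (B *m m%:M)); rewrite //.
- move=> i j; rewrite mul_mx_scalar !mxE rpredN mulrC -[d.+1]add1n.
  by rewrite dhomogM.
- have /colon/JE [v vE] : L (B i 0).
    by apply/LE; exists (delta_mx 0 i); rewrite -rowE mxE.
  exists (- v); apply/rowP=> j; rewrite mulNmx mul_mx_scalar ord1.
  by rewrite 2![LHS]mxE [RHS]mxE [(m *: B) _ _]mxE -vE mulrC.
exists k.+1, (r + 1)%N, (col_mx A m%:M); split.
- move=> i j; rewrite -[i]splitK; case: (fintype.split i) => i' /=.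
    by rewrite col_mxEu.
  by rewrite col_mxEd !ord1 mxE eqxx mulr1n.
- move=> p; split=> [[c [q' [/JE [v ->] ->]]]|[v ->]].
    exists (row_mx v c%:M); rewrite mul_row_col -scalar_mxM.
    by rewrite [RHS]mxE [_%:M _ _]mxE eqxx mulr1n.
  exists (rsubmx v 0 0), ((lsubmx v *m A) 0 0); split.
    by apply/JE; exists (lsubmx v).
  rewrite -{1}[v]hsubmxK mul_row_col {1}[rsubmx v]M1 -scalar_mxM.
  by rewrite [LHS]mxE [_%:M _ _]mxE eqxx mulr1n.
exists (rA + q)%N, (block_mx DA 0 C B); split; first exact: homog_block.
- move=> v; rewrite -[v]hsubmxK mul_row_col.
  have eB (w : 'rV_1) : (exists w', w = w' *m B) <->
      True /\ exists v, w *m m%:M = v *m A.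
    rewrite {1 2}[w]M1; split=> [[w' w'E]|[_ [v' v'E]]].
      have /colon/JE [v' v'E] : L (w 0 0).
        by apply/LE; exists w'; rewrite -w'E mxE eqxx mulr1n.
      by split=> //; exists v'; rewrite -scalar_mxM v'E -M1.
    have /colon/LE [w' w'E] : J (w 0 0 * m).
      by apply/JE; exists v'; rewrite -v'E -scalar_mxM mxE eqxx mulr1n.
    by exists w'; rewrite w'E -M1.
  by rewrite -(cone_syzygies eDA eB CE); split=> [|[]].
- apply: (@lin_res_block _ 1%N) => // w wB; apply/eDA.
  by rewrite -mulmxA -CE mulmxN mulmxA wB mul0mx oppr0.
Qed.

(** A finite resolution, extended by zero modules, as the infinite sequence
    that a complex requires; [D0] is kept apart from [D] so that the induction
    can put a new matrix in front without casting dimensions. *)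
Lemma lin_res_complex k r s (A : 'M[S]_(r, s)) : lin_res k A ->
  exists (rk : nat -> nat) (D0 : 'M[S]_(rk 0%N, r))
    (D : forall i, 'M[S]_(rk i.+1, rk i)),
    [/\ homog_mx 1 D0, exact_at D0 A, forall i, homog_mx 1 (D i),
        exact_at (D 0%N) D0 & forall i, exact_at (D i.+1) (D i)].
Proof.
elim: k r s A => [|k IHk] r s A.
  move=> /= r0; subst r; exists (fun=> 0%N), 0, (fun=> 0).
  have ex0 s' (M : 'M[S]_(0, s')) : exact_at (0 : 'M_0) M.
    move=> v; rewrite [v]thinmx0 mul0mx; split=> // _.
    by exists 0; rewrite mul0mx.
  by split=> // [[]//|i []].
case=> q [D [hD eD /IHk [rk [D0 [D' [hD0 eD0 hD' eD1 eD']]]]]].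
exists (fun i => if i is i'.+1 then rk i' else q), D.
pose rk' i := if i is i'.+1 then rk i' else q.
exists (fun i => match i return 'M[S]_(rk' i.+1, rk' i) with
  | 0%N => D0 | i'.+1 => D' i' end).
by split=> // [[]|[]].
Qed.

(** All basis vectors of the i-th module have degree [d + i], so the strand of
    degree [i + j] vanishes as soon as [j] differs from [d]. *)
Lemma ideal_lin_res_linear d (J : S -> Prop) :
  ideal_lin_res d J -> linear_resolution d J.
Proof.
case=> k [r [A [hA JE /lin_res_complex[rk [D0 [D [hD0 eD0 hD eD1 eD]]]]]]].
move=> i j jd.
pose rk' i := if i is i'.+1 then rk i' else r.
pose D' i := match i return 'M[S]_(rk' i.+1, rk' i) with
  | 0%N => D0 | i'.+1 => D i' end.
pose F := @FreeComplex K n rk' (fun i _ => (d + i)%:Z) D' A.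
have hD' l : homog_mx 1 (D' l) by case: l.
exists F.
  split=> //=; try by case.
  - by move=> b; rewrite addn0.
  - move=> l b c; rewrite addnS -addn1 PoszD addrC addKr.
    exact: hD'.
have c0 : compK F i (i%:Z + j) = 0.
  apply/matrixP=> b c; rewrite !mxE /= -[RHS](mul0rn _ (b == c)).
  congr (_ *+ _); case: eqP => // /esym; rewrite addnC PoszD => /addrI /jd [].
rewrite /dim_homK; suff -> : cyclesK F i (i%:Z + j) = 0 by rewrite mxrank0.
case: i c0 {jd} => [|i] c0 /=; first exact: c0.
by rewrite c0 cap0mx.
Qed.

End LinearResolutions.

(** * Linear quotients of lists of monomials *)

Section LinearQuotients.

Variables (n : nat).
Implicit Types (s : seq 'X_{1..n}) (u v w m : 'X_{1..n}).

Definition covered s m : bool := has (fun u => (u <= m)%MM) s.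

Lemma coveredP s m : reflect (exists2 u, u \in s & (u <= m)%MM) (covered s m).
Proof. exact: hasP. Qed.

(** The colon ideal of [s1] by [u] is generated by the x^(v - gcd(u, v)) with
    [v] in [s1]; each of these must be divisible by a variable of the colon
    ideal. *)
Definition linear_quotients s : Prop :=
  forall s1 u s2, s = s1 ++ u :: s2 -> forall v, v \in s1 ->
    exists w i, [/\ w \in s1, (u i < v i)%N & (w <= U_(i) + u)%MM].

Definition colon_vars s u : seq 'I_n :=
  [seq i <- enum 'I_n | covered s (U_(i) + u)].

(** The colon ideal by x^u is generated by variables: if [v] divides x^(u + m)
    and [u_i < v_i], then [x_i] divides x^m. *)
Lemma covered_colon s u :
  (forall v, v \in s ->
     exists w i, [/\ w \in s, (u i < v i)%N & (w <= U_(i) + u)%MM]) ->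
  forall m, covered s (u + m) = covered [seq U_(i)%MM | i <- colon_vars s u] m.
Proof.
move=> lq m; apply/coveredP/coveredP.
  case=> v /lq[w [i [ws ui wi]]] /mnm_lepP/(_ i).
  rewrite mnmDE => vi; exists U_(i)%MM.
    by apply/map_f; rewrite mem_filter mem_enum andbT; apply/coveredP; exists w.
  rewrite lep1mP; apply: contraTneq vi => ->.
  by rewrite addn0 -ltnNge.
case=> u' /mapP [i]; rewrite mem_filter => /andP [/coveredP [w ws wi] _] -> im.
exists w => //; apply: lepm_trans wi _; apply/mnm_lepP=> j.
by rewrite !mnmDE addnC leq_add2l; apply: (mnm_lepP im).
Qed.

(** The orders on monomials used below: first by increasing [f], then by
    decreasing monomial order, which is lexicographic within a degree. *)
Definition key_lt (f : 'X_{1..n} -> nat) u v : bool :=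
  (f u < f v)%N || (f u == f v) && (v < u)%O.

Definition key_le (f : 'X_{1..n} -> nat) u v : bool :=
  (u == v) || key_lt f u v.

Lemma key_lt_trans f : transitive (key_lt f).
Proof.
move=> v u w /orP[uv|/andP[/eqP uv uv']] /orP[vw|/andP[/eqP vw vw']]; apply/orP.
- by left; apply: ltn_trans vw.
- by left; rewrite -vw.
- by left; rewrite uv.
- by right; rewrite uv vw eqxx (lt_trans vw').
Qed.

Lemma key_lt_irr f u : key_lt f u u = false.
Proof. by rewrite /key_lt ltnn ltxx andbF. Qed.

Lemma key_le_trans f : transitive (key_le f).
Proof.
move=> v u w /predU1P[->//|uv] /predU1P[<-|vw]; apply/orP; right=> //.
exact: key_lt_trans vw.
Qed.

Lemma key_le_total f : total (key_le f).
Proof.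
move=> u v; rewrite /key_le /key_lt [v == u]eq_sym [f v == _]eq_sym.
case: (eqVneq u v) => //= uv.
by case: ltngtP => //= _; case: ltgtP uv => // ->; rewrite eqxx.
Qed.

(** For a strict total order, the prefix before [u] in the sorted list consists
    of the smaller elements, so the condition needs no decomposition of lists. *)
Lemma linear_quotients_sort f s : uniq s ->
  (forall u v, u \in s -> v \in s -> key_lt f v u ->
     exists w i, [/\ w \in s, key_lt f w u, (u i < v i)%N
                   & (w <= U_(i) + u)%MM]) ->
  linear_quotients (sort (key_le f) s).
Proof.
move=> us lq s1 u s2 sE v vs1.
have := sort_uniq (key_le f) s; rewrite us sE cat_uniq cons_uniq.
case/and3P=> _ us1 /andP[us2 _].
have memE w : (w \in s) = (w \in s1 ++ u :: s2) by rewrite -sE mem_sort.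
have := sort_sorted (key_le_total f) s.
rewrite sE (sorted_pairwise (@key_le_trans f)) pairwise_cat allrel_consr /=.
case/and3P=> /andP[/allP s1u _] _ /andP[/allP us2' _].
have := s1u _ vs1; rewrite /key_le; case: eqP => [vu|_ /= vu].
  by case/hasP: us1; exists u; rewrite ?mem_head //= -vu.
have [||//|w [i [ws wu ui wi]]] := lq u v;
  rewrite ?memE ?mem_cat ?vs1 ?mem_head ?orbT //.
exists w, i; split=> //.
move: ws; rewrite memE mem_cat inE => /or3P[//|/eqP wE|/us2' /predU1P[wE|uw]].
- by rewrite wE key_lt_irr in wu.
- by rewrite wE key_lt_irr in wu.
- by have := key_lt_trans wu uw; rewrite key_lt_irr.
Qed.

Lemma mdeg_lt_exists u v : (mdeg u < mdeg v)%N -> exists i, (u i < v i)%N.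
Proof.
move=> uv; apply/existsP; apply: contraTT uv => /existsPn vu.
by rewrite -leqNgt !mdegE; apply: leq_sum => i _; rewrite leqNgt.
Qed.

Lemma lepm_mdeg u v : (u <= v)%MM -> (mdeg u <= mdeg v)%N.
Proof. by move/submK <-; rewrite mdegD leq_addl. Qed.

Lemma lepm_mdeg_eq u v : (u <= v)%MM -> mdeg u = mdeg v -> u = v.
Proof.
move/submK => vE; rewrite -vE mdegD -[LHS]add0n => /addIn/esym/eqP.
by rewrite mdeg_eq0 => /eqP ->; rewrite add0m.
Qed.

Definition exchange u i j : 'X_{1..n} := (U_(i) + u - U_(j))%MM.

Lemma mdeg_exchange u i j :
  ((U_(i) + u)%MM j != 0)%N -> mdeg (exchange u i j) = mdeg u.
Proof.
rewrite -lep1mP => /submK /(congr1 (@mdeg n)).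
by rewrite !mdegD !mdeg1 addn1 add1n => -[].
Qed.

Lemma exchange_gt u (i j : 'I_n) :
  (i < j)%N -> u j != 0%N -> (u < exchange u i j)%O.
Proof.
move=> ij uj.
apply/ltmcP; first by rewrite mdeg_exchange // mnmDE addn_eq0 negb_and uj orbT.
have ij' : (j == i) = false by rewrite -val_eqE /= gtn_eqF.
exists i => [k ki|].
  rewrite mnmBE mnmDE !mnm1E -!val_eqE /= !gtn_eqF ?subn0 //.
  exact: ltn_trans ki ij.
by rewrite mnmBE mnmDE !mnm1E eqxx ij' subn0 add1n.
Qed.

Definition monomials_of_deg d s : seq 'X_{1..n} :=
  [seq m <- [seq val b | b : 'X_{1..n < d.+1}] | (mdeg m == d) && covered s m].

Lemma mem_monomials_of_deg d s m :
  (m \in monomials_of_deg d s) = (mdeg m == d) && covered s m.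
Proof.
rewrite mem_filter andb_idr // => /andP[/eqP md _].
have md' : (mdeg m < d.+1)%N by rewrite md.
by apply/imageP; exists (BMultinom md').
Qed.

Definition first_divisor s m : nat := find (fun u => (u <= m)%MM) s.

Lemma first_divisor_le s u m :
  u \in s -> (u <= m)%MM -> (first_divisor s m <= index u s)%N.
Proof.
move=> us um; rewrite leqNgt; apply/negP => /(before_find u).
by rewrite nth_index ?um.
Qed.

Lemma lex_gt_exchange u v : mdeg u = mdeg v -> (u < v)%O ->
  exists i j : 'I_n, [/\ (i < j)%N, (u i < v i)%N & (v j < u j)%N].
Proof.
move=> uv /(ltmcP uv) [i ltE ui].
have [|j] := @mdeg_lt_exists v (U_(i) + u)%MM; first by rewrite mdegD mdeg1 uv.
rewrite mnmDE mnm1E => vj; exists i, j; split=> //.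
  rewrite ltnNge leq_eqVlt; apply/negP => /orP[/eqP/val_inj ji|ji]; move: vj.
    by rewrite ji eqxx add1n ltnS leqNgt ui.
  by rewrite -val_eqE /= gtn_eqF // ltE // ltnn.
by move: vj; case: eqP => // <-; rewrite add1n ltnS leqNgt ui.
Qed.

(** Let [g] be the first element of [s] that divides [u].  If [v] comes from an
    earlier element, the linear quotients of [s] yield [w] before [g] with [w]
    dividing [x_i x^g].  Then [u] and [g] agree at [i], since otherwise [w]
    would divide [u]; and as [w] has degree at most [d], some [x_j] can be
    dropped from [x_i x^u] keeping it a multiple of [w].  If [v] comes from [g]
    as well, then x_i x^u / x_j works, where [i] is the first place where [u]
    and [v] differ and [u_j > v_j] at a later place [j]: what is removed is not
    part of [g]. *)
Lemma linear_quotients_component d s :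
  linear_quotients s -> pairwise (relpre (@mdeg n) leq) s ->
  linear_quotients
    (sort (key_le (first_divisor s)) (monomials_of_deg d s)).
Proof.
move=> lq degs; apply: linear_quotients_sort.
  by rewrite filter_uniq // map_inj_uniq ?enum_uniq //; apply: val_inj.
move=> u v; rewrite !mem_monomials_of_deg => /andP[/eqP ud us] /andP[/eqP vd vs].
have ltu : (first_divisor s u < size s)%N by rewrite -has_find.
have ltv : (first_divisor s v < size s)%N by rewrite -has_find.
have gu : (nth 0%MM s (first_divisor s u) <= u)%MM by exact: (nth_find 0%MM us).
have gv : (nth 0%MM s (first_divisor s v) <= v)%MM by exact: (nth_find 0%MM vs).
set k := first_divisor s u in ltu gu *; set l := first_divisor s v in ltv gv *.
rewrite {1}/key_lt -/k -/l; case/orP => [lk|/andP[/eqP lk uv]].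
- have [] := lq (take k s) (nth 0%MM s k) (drop k.+1 s) _ (nth 0%MM s l).
  + by rewrite -drop_nth // cat_take_drop.
  + by rewrite -(nth_take _ lk) mem_nth // size_take ltu.
  move=> w [i [ws ui wi]].
  have wsk : (index w s < k)%N.
    rewrite -[s](cat_take_drop k) index_cat ws.
    by rewrite -index_mem size_take ltu in ws.
  have ws' : w \in s by apply: mem_take ws.
  have wu : (w <= U_(i) + u)%MM.
    apply: lepm_trans wi _; apply/mnm_lepP => j.
    by rewrite !mnmDE leq_add2l; apply: (mnm_lepP gu).
  (* Otherwise w divides u, although it comes before the first divisor g. *)
  have uE : u i = nth 0%MM s k i.
    apply/eqP; rewrite eqn_leq (mnm_lepP gu) andbT leqNgt; apply/negP => gui.
    have /(first_divisor_le ws') : (w <= u)%MM.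
      apply: lepm_trans wi _; apply/mnm_lepP => j; rewrite mnmDE mnm1E.
      by case: eqP => [<-|_]; rewrite ?add1n //; apply: (mnm_lepP gu).
    by rewrite leqNgt wsk.
  have wd : (mdeg w <= d)%N.
    have: (mdeg w <= mdeg (nth 0%MM s k))%N.
      move: degs; rewrite -{1}[s](cat_take_drop k) pairwise_cat (drop_nth 0%MM) //.
      by rewrite allrel_consr => /andP[/andP[/allP/(_ _ ws)]].
    by move=> /leq_trans; apply; rewrite -ud lepm_mdeg.
  (* deg w <= d < deg (x_i x^u), so a variable can be dropped. *)
  have [j wj] : exists j, (w j < (U_(i) + u)%MM j)%N.
    by apply: mdeg_lt_exists; rewrite mdegD mdeg1 ud.
  have uj : (U_(i) + u)%MM j != 0%N by rewrite -lt0n (leq_ltn_trans _ wj).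
  have we : (w <= exchange u i j)%MM.
    apply/mnm_lepP => h; rewrite mnmBE mnm1E; case: eqP => [<-|_].
      by rewrite leq_subRL ?add1n // lt0n.
    by rewrite subn0; apply: (mnm_lepP wu).
  exists (exchange u i j), i; split.
  + rewrite mem_monomials_of_deg mdeg_exchange // ud eqxx.
    by apply/coveredP; exists w.
  + by apply/orP; left; apply: leq_ltn_trans (first_divisor_le ws' we) wsk.
  + by rewrite uE (leq_trans ui) //; apply: (mnm_lepP gv).
  + exact: lem_subr.
have [|i [j [ij ui vj]]] := lex_gt_exchange _ uv; first by rewrite ud.
have uj : u j != 0%N by rewrite -lt0n (leq_ltn_trans _ vj).
have we : (nth 0%MM s k <= exchange u i j)%MM.
  apply/mnm_lepP => h; rewrite mnmBE mnmDE !mnm1E; case: (eqVneq j h) => [<-|_].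
    rewrite -val_eqE /= ltn_eqF // add0n leq_subRL ?lt0n // add1n.
    by apply: leq_ltn_trans vj; rewrite -lk; apply: (mnm_lepP gv).
  by rewrite subn0 (leq_trans (mnm_lepP gu h)) // leq_addl.
have gs : nth 0%MM s k \in s by rewrite mem_nth.
exists (exchange u i j), i; split=> //.
- rewrite mem_monomials_of_deg mdeg_exchange; last first.
    by rewrite mnmDE addn_eq0 negb_and uj orbT.
  by rewrite ud eqxx; apply/coveredP; exists (nth 0%MM s k).
- rewrite /key_lt (exchange_gt ij uj) andbT orbC -leq_eqVlt -/k.
  rewrite leqNgt; apply/negP => /(before_find 0%MM).
  by rewrite we.
- exact: lem_subr.
Qed.

End LinearQuotients.

(** * From linear quotients to linear resolutions *)

Section MonomialIdeals.

Variables (K : fieldType) (n : nat).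
Local Notation S := {mpoly K[n]}.
Implicit Types (s : seq 'X_{1..n}) (u v w m : 'X_{1..n}) (I : S -> Prop).

Definition mon_ideal s (p : S) : Prop :=
  forall m, m \in msupp p -> covered s m.

Lemma mon_ideal_colon s u (c : S) :
  mon_ideal s (c * 'X_[u]) <-> (forall m, m \in msupp c -> covered s (u + m)).
Proof.
have E := perm_mem (msuppMX c u).
split=> H m; first by move=> mc; apply: H; rewrite E map_f.
by rewrite E => /mapP[m' mc ->]; apply: H.
Qed.

Lemma mon_ideal_rcons s u (p : S) :
  mon_ideal (rcons s u) p <->
  exists c q, mon_ideal s q /\ p = q + c * 'X_[u].
Proof.
have covE m : covered (rcons s u) m = covered s m || (u <= m)%MM.
  by rewrite /covered has_rcons orbC.
split=> [pI|[c [q [qI ->]]] m /msuppD_le].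
- exists (\sum_(m <- msupp p | ~~ covered s m) p@_m *: 'X_[m - u]).
  exists (\sum_(m <- msupp p | covered s m) p@_m *: 'X_[m]); split.
    move=> m; apply: contraTT => nm; rewrite -mcoeff_eq0 raddf_sum /=.
    rewrite big1 // => m' sm'; rewrite mcoeffZ mcoeffX.
    by case: eqP nm => [<-|_ _]; rewrite ?mulr0 // sm'.
  rewrite [LHS]mpolyE (bigID (covered s)) /= mulr_suml; congr (_ + _).
  rewrite big_seq_cond [RHS]big_seq_cond; apply: eq_bigr => m /andP[mp nm].
  rewrite -scalerAl -mpolyXD submK //.
  by have := pI _ mp; rewrite covE (negPf nm).
rewrite mem_cat covE => /orP[/qI ->//|].
rewrite (perm_mem (msuppMX _ _)) => /mapP [m' _ ->].
by rewrite lem_addr orbT.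
Qed.

Lemma mon_ideal0 (p : S) : p = 0 <-> mon_ideal [::] p.
Proof.
split=> [->|pI]; first by move=> m; rewrite msupp0.
apply/eqP; rewrite -msupp_eq0; case E: (msupp p) => [//|m t].
by have := pI m; rewrite E mem_head => /(_ isT).
Qed.

Lemma ideal_lin_res_rcons d s u : mdeg u = d ->
  ideal_lin_res d (mon_ideal s) ->
  ideal_lin_res 1 (mon_ideal [seq U_(i)%MM | i <- colon_vars s u]) ->
  (forall v, v \in s ->
     exists w i, [/\ w \in s, (u i < v i)%N & (w <= U_(i) + u)%MM]) ->
  ideal_lin_res d (mon_ideal (rcons s u)).
Proof.
move=> du rs rv lq.
apply: ideal_lin_res_ext (fun p => iff_sym (mon_ideal_rcons s u p)) _.
apply: ideal_lin_res_add rs rv _; first by rewrite dhomogX; apply/eqP.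
move=> c; rewrite mon_ideal_colon; split=> cI m /cI.
  by rewrite covered_colon.
by rewrite -covered_colon.
Qed.

(** Adding a variable [x_i] to an ideal of other variables: the colon ideal is
    the same ideal, already resolved. *)
Lemma ideal_lin_res_vars (t : seq 'I_n) : uniq t ->
  ideal_lin_res 1 (mon_ideal [seq U_(i)%MM | i <- t]).
Proof.
elim/last_ind: t => [_|t i IHt].
  exact: ideal_lin_res_ext mon_ideal0 (ideal_lin_res0 K n 1).
rewrite rcons_uniq map_rcons => /andP[it /IHt rt].
apply: ideal_lin_res_rcons => //; first exact: mdeg1.
  apply: ideal_lin_res_ext rt => p.
  set L := [seq U_(j)%MM | j <- t].
  suff E : covered L =1 covered [seq U_(j)%MM | j <- colon_vars L U_(i)%MM].
    by split=> pI m /pI; rewrite E.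
  have tE j : (j \in colon_vars L U_(i)%MM) = (j \in t).
    rewrite mem_filter mem_enum andbT; apply/coveredP/idP.
      case=> w /mapP[k kt ->]; rewrite lep1mP mnmDE !mnm1E.
      by case: (eqVneq j k) => [->//|_]; case: (eqVneq i k) => // ik;
        rewrite ik kt in it.
    by move=> jt; exists U_(j)%MM; rewrite ?map_f ?lem_addr.
  by move=> m; apply: eq_has_r; apply: eq_mem_map => j; rewrite tE.
move=> v /mapP[j jt ->]; exists U_(j)%MM, j; split; rewrite ?map_f ?lem_addr //.
by rewrite !mnm1E eqxx; case: eqP => // ij; rewrite ij jt in it.
Qed.

Lemma linear_quotients_lin_res d s : {in s, forall u, mdeg u = d} ->
  linear_quotients s -> ideal_lin_res d (mon_ideal s).
Proof.
elim/last_ind: s => [_ _|s u IHs sd lq].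
  exact: ideal_lin_res_ext mon_ideal0 (ideal_lin_res0 K n d).
apply: ideal_lin_res_rcons.
- by apply: sd; rewrite mem_rcons mem_head.
- apply: IHs => [v vs|s1 v s2 sE].
    by apply: sd; rewrite mem_rcons inE vs orbT.
  by apply: (lq s1 v (rcons s2 u)); rewrite sE rcons_cat rcons_cons.
- by apply: ideal_lin_res_vars; rewrite filter_uniq ?enum_uniq.
- by apply: (lq s u [::]); rewrite cats1.
Qed.

(** * Monomial ideals and their minimal generators *)

Lemma ideal_gen_ind (A J : S -> Prop) :
  J 0 -> (forall p q, J p -> J q -> J (p + q)) ->
  (forall c p, A p -> J (c * p)) -> forall p, ideal_gen A p -> J p.
Proof.
move=> J0 JD JM p [s sA ->]; rewrite big_seq.
by apply: big_ind => // x /sA; apply: JM.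
Qed.

Lemma ideal_gen_sum (T : eqType) (A : S -> Prop) (r : seq T) (F : T -> S) :
  (forall x, x \in r -> exists c p, A p /\ F x = c * p) ->
  ideal_gen A (\sum_(x <- r) F x).
Proof.
elim: r => [_|x r IHr rA]; first by exists [::]; rewrite ?big_nil.
have [c [p [Ap Fx]]] := rA x (mem_head _ _).
have [|s sA sE] := IHr; first by move=> y yr; apply: rA; rewrite inE yr orbT.
exists ((c, p) :: s); last by rewrite !big_cons Fx sE.
by move=> y; rewrite inE => /predU1P[->//|/sA].
Qed.

Lemma msupp_mulP (c p : S) m : m \in msupp (c * p) ->
  exists2 m', m' \in msupp p & (m' <= m)%MM.
Proof.
case/msuppM_le/allpairsP => -[m1 m2] /= [_ m2p ->].
by exists m2; rewrite ?lem_addl.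
Qed.

Lemma ideal_gen_monomialsP (U : 'X_{1..n} -> Prop) (p : S) :
  ideal_gen (monomials U) p <->
  forall m, m \in msupp p -> exists2 u, U u & (u <= m)%MM.
Proof.
split=> [|pU].
  move: p; apply: ideal_gen_ind => [m|p q pU qU m|c _ [u Uu ->] m].
  - by rewrite msupp0.
  - by move/msuppD_le; rewrite mem_cat => /orP[/pU|/qU].
  - by case/msupp_mulP => m' /mem_msuppXP <-; exists u.
rewrite [p]mpolyE; apply: ideal_gen_sum => m /pU [u Uu um].
exists (p@_m *: 'X_[m - u]), 'X_[u]; split; first by exists u.
by rewrite -scalerAl -mpolyXD submK.
Qed.

(** Minimality for divisibility among the monomials of [I], in place of
    minimality of a generating set; [min_gen_G] compares the two. *)
Definition min_gen I u : Prop :=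
  I 'X_[u] /\ forall w, (w <= u)%MM -> I 'X_[w] -> w = u.

Lemma monomial_idealX I m w : monomial_ideal I ->
  (w <= m)%MM -> I 'X_[w] -> I 'X_[m].
Proof.
case=> U UI wm /UI/ideal_gen_monomialsP H.
apply/UI/ideal_gen_monomialsP => _ /mem_msuppXP <-.
have [|u Uu uw] := H w; first exact/mem_msuppXP.
by exists u => //; apply: lepm_trans uw wm.
Qed.

Lemma monomial_idealP I p : monomial_ideal I ->
  (I p <-> forall m, m \in msupp p -> I 'X_[m]).
Proof.
case=> U UI; split=> [/UI/ideal_gen_monomialsP H m /H [u Uu um]|H].
  by apply/UI/ideal_gen_monomialsP => _ /mem_msuppXP <-; exists u.
apply/UI/ideal_gen_monomialsP => m /H /UI/ideal_gen_monomialsP; apply.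
exact/mem_msuppXP.
Qed.

Lemma min_gen_exists I m : I 'X_[m] -> exists2 u, min_gen I u & (u <= m)%MM.
Proof.
have [k] := ubnP (mdeg m); elim: k m => // k IHk m; rewrite ltnS => mk Im.
case: (classic (min_gen I m)) => [|nm]; first by exists m; rewrite ?lepm_refl.
have [w [wm Iw ne]] : exists w, [/\ (w <= m)%MM, I 'X_[w] & w <> m].
  apply: NNPP => nw; apply: nm; split=> // w wm Iw; apply: NNPP => ne.
  by apply: nw; exists w.
have wd : (mdeg w < mdeg m)%N.
  rewrite ltn_neqAle lepm_mdeg // andbT.
  by apply/eqP => /(lepm_mdeg_eq wm).
have [|u gu uw] := IHk w _ Iw; first exact: leq_trans wd mk.
by exists u => //; apply: lepm_trans uw wm.
Qed.

Lemma min_gen_G I u : monomial_ideal I -> min_gen I u -> G I u.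
Proof.
move=> monI gu; exists (min_gen I) => //; split=> [p|V VU VI w gw].
  rewrite monomial_idealP // ideal_gen_monomialsP.
  split=> H m /H; first exact: min_gen_exists.
  by case=> v [Iv _]; move/monomial_idealX; apply.
have /VI/ideal_gen_monomialsP/(_ w) [|v Vv vw] := proj1 gw.
  exact/mem_msuppXP.
by have [Iv _] := VU _ Vv; rewrite -(proj2 gw v vw Iv).
Qed.

(** Only finitely many monomials have degree at most [d], so excluded middle,
    applied to each of them, is enough to list the generators. *)
Lemma min_gens_upto I d : exists s, uniq s /\
  forall u, u \in s <-> min_gen I u /\ (mdeg u <= d)%N.
Proof.
have filter_ex (r : seq 'X_{1..n}) : uniq r -> exists s, uniq s /\
    forall u, u \in s <-> u \in r /\ min_gen I u.
  elim: r => [_|x r IHr /= /andP[xr /IHr [s [us sE]]]].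
    by exists [::]; split=> // u; split=> [//|[]].
  case: (classic (min_gen I x)) => gx.
    exists (x :: s) => /=; split.
      by rewrite us andbT; apply/negP => /sE[]; rewrite (negPf xr).
    move=> u; rewrite !inE; split=> [/predU1P[->|/sE[-> gu]]|[/predU1P[->|ur gu]]].
    + by rewrite eqxx.
    + by rewrite orbT.
    + by rewrite eqxx.
    + by apply/orP; right; apply/sE.
  exists s; split=> // u; rewrite inE; split=> [/sE[-> gu]|[/predU1P[->|ur gu]]] //.
    by rewrite orbT.
  exact/sE.
have [|s [us sE]] := filter_ex [seq val b | b : 'X_{1..n < d.+1}].
  by rewrite map_inj_uniq ?enum_uniq //; apply: val_inj.
exists s; split=> // u; rewrite sE; split=> -[].
  by move=> /imageP[b _ ->]; split=> //; rewrite -ltnS bmdeg.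
move=> gu ud; split=> //.
by apply/imageP; exists (BMultinom (ud : (mdeg u < d.+1)%N)).
Qed.

Lemma component_idealE I d s : monomial_ideal I ->
  (forall u, u \in s <-> min_gen I u /\ (mdeg u <= d)%N) ->
  forall p, mon_ideal (monomials_of_deg d s) p <-> component_ideal d I p.
Proof.
move=> monI sE p.
have IE m : mdeg m = d -> covered s m <-> I 'X_[m].
  move=> md; split=> [/coveredP [u /sE [[Iu _] _] um]|/min_gen_exists [u gu um]].
    exact: monomial_idealX um Iu.
  apply/coveredP; exists u => //; apply/sE; split=> //.
  by rewrite -md lepm_mdeg.
split=> [pI|].
  rewrite [p]mpolyE; apply: ideal_gen_sum => m /pI /coveredP [u].
  rewrite mem_monomials_of_deg => /andP[/eqP ud us] um.
  exists (p@_m *: 'X_[m - u]), 'X_[u]; split; last first.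
    by rewrite -scalerAl -mpolyXD submK.
  by split; [apply/IE | rewrite dhomogX; apply/eqP].
move: p; apply: ideal_gen_ind => [m|p q pI qI m|c p [Ip pd] m].
- by rewrite msupp0.
- by move/msuppD_le; rewrite mem_cat => /orP[/pI|/qI].
- case/msupp_mulP => m' m'p m'm; apply/coveredP; exists m' => //.
  have m'd := dhomog_mf pd m'p.
  rewrite mem_monomials_of_deg; apply/andP; split; first exact/eqP.
  apply/IE => //.
  exact: (proj1 (monomial_idealP _ monI) Ip).
Qed.

(** * Stable ideals have linear quotients *)

Lemma is_m_exists u : u != 0%MM -> exists k, is_m u k.
Proof.
rewrite -mdeg_eq0 mdegE sum_nat_eq0 => /forallPn [i]; rewrite implyTb => ui.
have [k uk kmax] := @arg_maxnP _ i (fun i => u i != 0%N) val ui.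
exists k; rewrite /is_m uk /=; apply/forallP => j.
by apply/implyP => uj; apply: kmax.
Qed.

Lemma is_m_gt u (k i : 'I_n) : is_m u k -> (k < i)%N -> u i = 0%N.
Proof.
case/andP=> _ /forallP/(_ i) ki.
by rewrite ltnNge; apply: contraNeq => /(implyP ki).
Qed.

Lemma ltn_bound_pred c e (b : option nat) :
  (c < e)%N -> ltn_bound e b -> ltn_bound c (pred_bound b).
Proof. by case: b => //= b ce eb; rewrite ltn_predRL (leq_trans _ eb). Qed.

(** Induction on the excess of [v] over [u].  As long as [v] does not divide
    [u], its last variable [x_l] is in excess, and for degree reasons some
    [x_j] is in defect, necessarily with [j <= k] and [j < l].  Since
    [v_j < u_j < a_j], stability applies to [v]: a generator dividing
    [x_j x^v / x_l] has smaller excess, and it does not come after [v]. *)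
Lemma a_stable_key_le a I u v (k : 'I_n) : a_stable a I ->
  min_gen I u -> min_gen I v -> (mdeg v <= mdeg u)%N -> is_m u k ->
  (forall j : 'I_n, (j < k)%N -> (v j <= u j)%N) ->
  key_le (@mdeg n) u v.
Proof.
move=> [[monI bdI] stI] gu gv + uk.
move: {2}(\sum_i (v i - u i))%N (leqnn (\sum_i (v i - u i))%N) => N.
elim: N v gv => [|N IHN] v gv Nv vu vk.
  have {}vu' : (v <= u)%MM.
    apply/mnm_lepP => i; rewrite -subn_eq0; move: Nv.
    by rewrite leqn0 sum_nat_eq0 => /forallP/(_ i).
  by rewrite (proj2 gu v vu' (proj1 gv)) /key_le eqxx.
have [->|ne] := eqVneq v u; first by rewrite /key_le eqxx.
have /forallPn [i] : ~~ [forall i, (v i <= u i)%N].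
  apply/negP => /forallP vu'; case/eqP: ne; apply: (proj2 gu); last by case: gv.
  exact/mnm_lepP.
rewrite -ltnNge => ui.
have ki : (k <= i)%N by rewrite leqNgt; apply/negP => /vk; rewrite leqNgt ui.
have v0 : v != 0%MM by apply: contraTneq ui => ->; rewrite mnm0E.
have [l vl] := is_m_exists v0.
have il : (i <= l)%N.
  case/andP: vl => _ /forallP/(_ i)/implyP; apply.
  by rewrite -lt0n (leq_ltn_trans _ ui).
(* u vanishes beyond k, so the last variable of v is in excess as well. *)
have ul : (u l < v l)%N.
  have [E|il'] := eqVneq l i; first by rewrite E.
  rewrite (is_m_gt uk) ?lt0n; first by case/andP: vl.
  by rewrite (leq_ltn_trans ki) // ltn_neqAle il eq_sym andbT.
have [j vj] : exists j, (v j < u j)%N.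
  apply/existsP; apply: contraTT vu => /existsPn uv; rewrite -ltnNge !mdegE.
  rewrite [X in (X < _)%N](bigD1 l) // [X in (_ < X)%N](bigD1 l) //= -addSn.
  by rewrite leq_add // leq_sum // => h _; rewrite leqNgt.
have jk : (j <= k)%N.
  by rewrite leqNgt; apply/negP => /(is_m_gt uk) uj; rewrite uj in vj.
have jl : (j < l)%N.
  rewrite ltn_neqAle (leq_trans jk) ?(leq_trans ki) // andbT.
  by apply: contraTneq ul => /val_inj <-; rewrite -leqNgt ltnW.
have Iw : I 'X_[exchange v j l].
  apply: (stI v (min_gen_G monI gv) l j vl (ltnW jl)).
  exact/(ltn_bound_pred vj)/bdI/min_gen_G.
have [w gw wv] := min_gen_exists Iw.
have vl0 : v l != 0%N by case/andP: vl.
have dw : mdeg (exchange v j l) = mdeg v.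
  by rewrite mdeg_exchange // mnmDE addn_eq0 negb_and vl0 orbT.
have ev h : exchange v j l h = (v h + (j == h) - (l == h))%N.
  by rewrite mnmBE mnmDE !mnm1E addnC.
have wdv : (mdeg w <= mdeg v)%N by rewrite -dw lepm_mdeg.
have uw : key_le (@mdeg n) u w.
  apply: IHN => //.
  - rewrite -ltnS (leq_trans _ Nv) //.
    rewrite [X in (X < _)%N](bigD1 l) // [X in (_ < X)%N](bigD1 l) //= -addSn.
    apply: leq_add.
      have := mnm_lepP wv l.
      rewrite ev eqxx -val_eqE /= ltn_eqF // addn0 subn1 => wl.
      by apply: ltn_sub2r => //; apply: leq_ltn_trans wl _; rewrite ltn_predL lt0n.
    apply: leq_sum => h hl; have := mnm_lepP wv h.
    rewrite ev [l == h]eq_sym (negPf hl) subn0; case: eqP => [<-|_]; last first.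
      by rewrite addn0 => /leq_sub2r; apply.
    rewrite addn1 => wj; have -> // : (w j - u j = 0)%N.
    by apply/eqP; rewrite subn_eq0 (leq_trans wj).
  - exact: leq_trans wdv vu.
  - move=> h hk; have := mnm_lepP wv h.
    rewrite ev [l == h]eq_sym -[h == l]val_eqE /= ltn_eqF ?subn0; last first.
      by apply: leq_trans hk _; apply: leq_trans ki il.
    case: eqP => [<-|_]; rewrite ?addn1 ?addn0 => /leq_trans; apply=> //.
    exact: vk.
apply: key_le_trans uw _; rewrite /key_le /key_lt.
move: wdv; rewrite leq_eqVlt => /predU1P[dwv|->]; last by rewrite orbT.
have -> : w = exchange v j l by apply: lepm_mdeg_eq wv _; rewrite dw.
by rewrite dw eqxx exchange_gt ?orbT.
Qed.

(** [a_stable_key_le] provides [j < m(u)] with [u_j < v_j], and stability at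
    [u] provides the earlier generator dividing [x_j x^u]. *)
Lemma a_stable_linear_quotients a I d s : a_stable a I -> uniq s ->
  (forall u, u \in s <-> min_gen I u /\ (mdeg u <= d)%N) ->
  linear_quotients (sort (key_le (@mdeg n)) s).
Proof.
move=> stI us sE; apply: linear_quotients_sort => // u v.
move=> /sE[gu ud] /sE[gv vd] vu.
have [[monI bdI] stI'] := stI.
have vne : v <> u by move=> E; rewrite E key_lt_irr in vu.
have [u0|/is_m_exists [k uk]] := eqVneq u 0%MM.
  have uv : (u <= v)%MM by rewrite u0; apply/mnm_lepP => i; rewrite mnm0E.
  by case: vne; rewrite (proj2 gv u uv) //; case: gu.
have /existsP [j /andP[jk uj]] : [exists j : 'I_n, (j < k)%N && (u j < v j)%N].
  apply: contraPT (vu) => /existsPn vk.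
  have : key_le (@mdeg n) u v.
    apply: (a_stable_key_le stI gu gv _ uk).
      by case/orP: vu => [/ltnW//|/andP[/eqP-> _]].
    by move=> j jk; have := vk j; rewrite jk -leqNgt.
  case/predU1P => [/esym//|uv vu'].
  by have := key_lt_trans uv vu'; rewrite key_lt_irr.
have uk0 : u k != 0%N by case/andP: uk.
have Iw : I 'X_[exchange u j k].
  apply: (stI' u (min_gen_G monI gu) k j uk (ltnW jk)).
  exact/(ltn_bound_pred uj)/bdI/min_gen_G.
have [w gw wu] := min_gen_exists Iw.
have dw : mdeg (exchange u j k) = mdeg u.
  by rewrite mdeg_exchange // mnmDE addn_eq0 negb_and uk0 orbT.
have wdu : (mdeg w <= mdeg u)%N by rewrite -dw lepm_mdeg.
exists w, j; split=> //.
- by apply/sE; split=> //; apply: leq_trans wdu ud.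
- rewrite /key_lt; move: wdu; rewrite leq_eqVlt => /predU1P[dwu|->//].
  have -> : w = exchange u j k by apply: lepm_mdeg_eq wu _; rewrite dw.
  by rewrite dw eqxx exchange_gt ?orbT.
- exact: lepm_trans wu (lem_subr _ _).
Qed.

End MonomialIdeals.

Theorem theorem3p11 (K : fieldType) (charK : [pchar K] =i pred0) (n : nat)
    (a : 'I_n -> option nat) (a_ge2 : forall i, leq_bound 2 (a i))
    (I : {mpoly K[n]} -> Prop) (I_stable : a_stable a I) :
  componentwise_linear I.
Proof.
move=> d; have [[monI _] _] := I_stable.
have [s [us sE]] := min_gens_upto I d.
pose t := sort (key_le (@mdeg n)) s.
have tE u : u \in t <-> min_gen I u /\ (mdeg u <= d)%N by rewrite mem_sort.
have lqt : linear_quotients t by apply: a_stable_linear_quotients I_stable us sE.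
have degt : pairwise (relpre (@mdeg n) leq) t.
  have := sort_sorted (key_le_total (@mdeg n)) s.
  rewrite (sorted_pairwise (@key_le_trans _ _)); apply: sub_pairwise => u v.
  by case/predU1P => [->//|/orP[/ltnW|/andP[/eqP/= -> _]]] /=.
have := linear_quotients_component (d := d) lqt degt.
move/(linear_quotients_lin_res K (d := d)) => rt; apply: ideal_lin_res_linear.
apply: ideal_lin_res_ext (rt _) => [p|u]; last first.
  by rewrite mem_sort mem_monomials_of_deg => /andP[/eqP].
rewrite -(component_idealE monI tE).
by split=> pI m /pI; rewrite /covered (perm_has _ (permEl (perm_sort _ _))).
Qed.
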